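(* Let $p$ be a prime and $q\in\mathbb{Z}_p^\times$. Then $\iota_q:C_q\to\mathbb{Z}_p$ is an isometry if and only if either $p$ is odd and $q\in U^{(1)}$, or $p=2$ and $q\in U^{(2)}$. Moreover, every isometry $\iota_q$ preserves the norm, i.e. (in these cases, where $C_q=\mathbb{Z}_p$) $v_p(\iota_q(z))=v_p(z)$ for all $z\in\mathbb{Z}_p$.
   Context: $\mathbb{Z}_p$ is the ring of $p$-adic integers with valuation $v_p$ and the $p$-adic metric, $U^{(m)}=1+p^m\mathbb{Z}_p$. For $q\in\mathbb{Z}_p^\times$, let $\varphi:\widehat{\mathbb{Z}}\to\mathbb{Z}_p^\times$ be the continuous homomorphism with $\varphi(1)=q$, and for $q\neq 1$ let $C_q=\widehat{\mathbb{Z}}/\ker\varphi$, which acts on $\mathbb{Z}_p$ by $z*a=q^za$ where $q^z:=\varphi(z)$. $\iota_q:C_q\to\mathbb{Z}_p$ is the continuous $1$-cocycle with $\iota_q(1)=1$, i.e. $\iota_q(z)=(q^z-1)/(q-1)$; it extends $n\mapsto 1+q+\cdots+q^{n-1}$. If $q$ is not a root of unity, $C_q\cong\mathbb{Z}/o_p\mathbb{Z}\times\mathbb{Z}_p$, where $o_p$ is the order of $q$ modulo $p$ (so $C_q=\mathbb{Z}_p$ if also $q\in U^{(1)}$). For $q=1$, by convention $C_1=\mathbb{Z}_p$ and $\iota_1=\mathrm{id}$. An isometry is a surjective distance-preserving map; when $C_q=\mathbb{Z}_p$ the domain carries the $p$-adic metric, and otherwise any metric inducing the topology of $C_q$. 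*)

(* Defs.v *)
From HB Require Import structures.
From mathcomp Require Import all_boot all_order all_algebra.
From mathcomp Require Import all_classical all_reals all_analysis.
From mathcomp Require cyclic.
From mathcomp Require Import ring.

Set Implicit Arguments.
Unset Strict Implicit.
Unset Printing Implicit Defensive.

Import Order.TTheory GRing.Theory Num.Theory.
Local Open Scope classical_set_scope.
Local Open Scope ring_scope.

(* The inverse limit of the rings Z/(N i), for a family N of moduli ordered by
   divisibility. An element is a compatible family of canonical residues; taking
   i = j in the condition says that x i is reduced modulo N i. *)
Definition adic_compat (N : nat -> nat) (x : nat -> int) :=
  forall i j, (N i %| N j)%N -> (x j %% (N i)%:Z)%Z = x i.

Record adic (N : nat -> nat) :=
  Adic { residue :> nat -> int; _ : `[< adic_compat N residue >] }.

HB.instance Definition _ N := [isSub for @residue N].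
HB.instance Definition _ N := [Choice of adic N by <:].

Section AdicRing.
Variable N : nat -> nat.
Implicit Types x y z : adic N.

Lemma residueP x : adic_compat N x.
Proof. by case: x => x /= /asboolP. Qed.

Lemma residue_mod x i : (x i %% (N i)%:Z)%Z = x i.
Proof. exact: residueP. Qed.

Lemma adicP x y : (forall i, x i = y i) -> x = y.
Proof. by move=> xy; apply: val_inj; apply/funext. Qed.

Definition mk_adic (f : nat -> int) (fP : adic_compat N f) : adic N :=
  Adic (asboolT fP).

(* a choice of integers compatible up to congruence, reduced *)
Lemma reduce_compat (f : nat -> int) :
  (forall i j, (N i %| N j)%N -> (f j = f i %[mod (N i)%:Z])%Z) ->
  adic_compat N (fun i => (f i %% (N i)%:Z)%Z).
Proof.
move=> fP i j ij; rewrite -(fP i j) //; have [k ->] := dvdnP ij.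
by rewrite [in RHS](divz_eq (f j) (k * N i)%N%:Z) PoszM mulrA modzMDl.
Qed.
Definition reduce (f : nat -> int) fP := mk_adic (@reduce_compat f fP).

Lemma adic0_subproof : forall i j, (N i %| N j)%N ->
  ((fun=> 0 : int) j = (fun=> 0) i %[mod (N i)%:Z])%Z.
Proof. by []. Qed.

Lemma adic1_subproof : forall i j, (N i %| N j)%N ->
  ((fun=> 1 : int) j = (fun=> 1) i %[mod (N i)%:Z])%Z.
Proof. by []. Qed.

Lemma adicN_subproof x : forall i j, (N i %| N j)%N ->
  (- x j = - x i %[mod (N i)%:Z])%Z.
Proof. by move=> i j ij; rewrite -modzNm (residueP x ij). Qed.

Lemma adicD_subproof x y : forall i j, (N i %| N j)%N ->
  (x j + y j = x i + y i %[mod (N i)%:Z])%Z.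
Proof. by move=> i j ij; rewrite -modzDm !(residueP _ ij). Qed.

Lemma adicM_subproof x y : forall i j, (N i %| N j)%N ->
  (x j * y j = x i * y i %[mod (N i)%:Z])%Z.
Proof. by move=> i j ij; rewrite -modzMm !(residueP _ ij). Qed.

Definition adic0 := reduce adic0_subproof.
Definition adic1 := reduce adic1_subproof.
Definition adicN x := reduce (@adicN_subproof x).
Definition adicD x y := reduce (@adicD_subproof x y).
Definition adicM x y := reduce (@adicM_subproof x y).

Lemma adicDA : associative adicD.
Proof. by move=> x y z; apply/adicP => i /=; rewrite modzDml modzDmr addrA. Qed.
Lemma adicDC : commutative adicD.
Proof. by move=> x y; apply/adicP => i /=; rewrite addrC. Qed.
Lemma adic0D : left_id adic0 adicD.
Proof. by move=> x; apply/adicP => i /=; rewrite mod0z add0r residue_mod. Qed.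
Lemma adicND : left_inverse adic0 adicN adicD.
Proof. by move=> x; apply/adicP => i /=; rewrite modzDml addNr. Qed.
Lemma adicMA : associative adicM.
Proof. by move=> x y z; apply/adicP => i /=; rewrite modzMml modzMmr mulrA. Qed.
Lemma adicMC : commutative adicM.
Proof. by move=> x y; apply/adicP => i /=; rewrite mulrC. Qed.
Lemma adic1M : left_id adic1 adicM.
Proof. by move=> x; apply/adicP => i /=; rewrite modzMml mul1r residue_mod. Qed.
Lemma adicM1 : right_id adic1 adicM.
Proof. by move=> x; rewrite adicMC adic1M. Qed.
Lemma adicMDl : left_distributive adicM adicD.
Proof.
by move=> x y z; apply/adicP => i /=; rewrite modzMml modzDml modzDmr mulrDl.
Qed.
Lemma adicMDr : right_distributive adicM adicD.
Proof. by move=> x y z; rewrite adicMC adicMDl; congr adicD; exact: adicMC. Qed.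

HB.instance Definition _ :=
  GRing.isZmodule.Build (adic N) adicDA adicDC adic0D adicND.
HB.instance Definition _ :=
  GRing.Zmodule_isPzRing.Build (adic N) adicMA adic1M adicM1 adicMDl adicMDr.
HB.instance Definition _ :=
  GRing.PzRing_hasCommutativeMul.Build (adic N) adicMC.

End AdicRing.

(* The limit topology: the coarsest one for which all residues are continuous
   into discrete spaces. *)
Definition residues N (x : adic N) :
  prod_topology (fun _ : nat => discrete_topology int) := residue x.

HB.instance Definition _ N :=
  Topological.copy (adic N) (initial_topology (@residues N)).

(* residue i of z : Zhat is taken modulo i.+1, residue k of x : Z_p modulo p ^ k *)
Notation Zhat := (adic succn).

Definition padic_int p (_ : prime p) := adic (expn p).

Section PadicRing.
Variables (p : nat) (p_pr : prime p).
Local Notation Zp := (padic_int p_pr).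
Implicit Types x y : Zp.

HB.instance Definition _ := GRing.ComPzRing.copy Zp (adic (expn p)).
HB.instance Definition _ := Topological.copy Zp (adic (expn p)).

Lemma padic1_neq0 : (1 : Zp) != 0.
Proof.
apply/eqP => /(congr1 (fun x : Zp => residue x 1)) /=.
by rewrite expn1 mod0z modz_small // ltz_nat prime_gt1.
Qed.

HB.instance Definition _ := GRing.PzSemiRing_isNonZero.Build Zp padic1_neq0.

Definition padic_unit : pred Zp := fun x => `[< exists y, y * x = 1 >].

Definition padic_inv x : Zp :=
  if pselect (exists y, y * x = 1) is left h then projT1 (cid h) else x.

Lemma padic_mulVr : {in padic_unit, left_inverse 1 padic_inv *%R}.
Proof.
move=> x /asboolP xU; rewrite /padic_inv; case: pselect => // h.
by case: cid.
Qed.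

Lemma padic_unitPl x y : y * x = 1 -> padic_unit x.
Proof. by move=> yx; apply/asboolP; exists y. Qed.

Lemma padic_invr_out : {in [predC padic_unit], padic_inv =1 id}.
Proof.
move=> x; rewrite inE => /asboolPn xU; rewrite /padic_inv.
by case: pselect.
Qed.

HB.instance Definition _ := GRing.ComNzRing_hasMulInverse.Build Zp
  padic_mulVr padic_unitPl padic_invr_out.

Lemma padic_residue_lt x (i j : nat) :
  (i <= j)%N -> (x j %% (p ^ i)%N%:Z)%Z = x i.
Proof. by move=> ij; apply: (residueP x); exact: dvdn_exp2l. Qed.

Lemma padic_mulf_eq0 : GRing.integral_domain_axiom Zp.
Proof.
move=> x y xy0; apply/negPn/negP; rewrite negb_or => /andP[x0 y0].
have nz z : z != 0 :> Zp -> exists i, z i <> 0.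
  move=> /eqP z0; apply/existsNP => z_i0; apply: z0; apply/adicP => i.
  by rewrite z_i0 /= mod0z.
have [[i xi] [j yj]] := (nz x x0, nz y y0).
have /= := congr1 (fun z : Zp => residue z (i + j)) xy0; rewrite mod0z.
move/dvdz_mod0P.
have := padic_residue_lt x (leq_addr j i).
have := padic_residue_lt y (leq_addl i j).
move: (x (i + j)%N) (y (i + j)%N) => a b yE xE.
have {}xi : ~~ ((p ^ i)%N %| `|a|)%N by apply: contra_notN xi => h; rewrite -xE; exact/dvdz_mod0P.
have {}yj : ~~ ((p ^ j)%N %| `|b|)%N by apply: contra_notN yj => h; rewrite -yE; exact/dvdz_mod0P.
have a0 : (0 < `|a|)%N by rewrite lt0n; apply: contraNneq xi => ->.
have b0 : (0 < `|b|)%N by rewrite lt0n; apply: contraNneq yj => ->.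
rewrite dvdzE abszM /= pfactor_dvdn ?muln_gt0 ?a0 ?b0 // lognM //.
move: xi yj; rewrite !pfactor_dvdn // -!ltnNge => xi yj.
by apply/negP; rewrite -ltnNge -addSn leq_add // ltnW.
Qed.

HB.instance Definition _ :=
  GRing.ComUnitRing_isIntegral.Build Zp padic_mulf_eq0.

Definition padic_dvd (k : nat) x := exists y, x = p%:R ^+ k * y.

(* the p-adic valuation; None stands for v_p(0) = +oo *)
Definition vp x : option nat :=
  if pselect (exists k, ~~ `[< padic_dvd k.+1 x >]) is left h
  then Some (ex_minn h) else None.

Definition padic_norm (R : realType) x : R :=
  if vp x is Some k then p%:R ^- k else 0.

Definition padic_dist (R : realType) x y : R := padic_norm R (x - y).

(* U^(m) = 1 + p^m Z_p *)
Definition padic_U (m : nat) x : Prop := exists a, x = 1 + p%:R ^+ m * a.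

(* the projection of Zhat onto its factor Z_p *)
Lemma Zhat_Zp_subproof (z : Zhat) :
  adic_compat (expn p) (fun k => z (p ^ k).-1).
Proof.
have p_gt0 k : (0 < p ^ k)%N by rewrite expn_gt0 prime_gt0.
move=> i j ij; have := @residueP _ z (p ^ i).-1 (p ^ j).-1.
by rewrite !prednK ?p_gt0 //; exact.
Qed.
Definition Zhat_Zp (z : Zhat) : Zp := mk_adic (Zhat_Zp_subproof z).

(* z |-> q^z is the continuous homomorphism Zhat -> Z_p^* mapping 1 to q; it
   exists (qpowP) and is unique (is_qpow_unique). The constant default is only
   reached when q is not a unit. *)
Definition is_qpow (q : Zp) (f : Zhat -> Zp) :=
  [/\ continuous f, forall z, f z \is a GRing.unit,
      forall z w, f (z + w) = f z * f w & f 1 = q].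

Definition qpow (q : Zp) : Zhat -> Zp := xget (fun=> 1) (is_qpow q).

Lemma qpow0 q : qpow q 0 = 1.
Proof.
rewrite /qpow; case: xgetP => [f _ [_ fU fD _]|//].
by apply: (mulrI (fU 0)); rewrite -fD addr0 mulr1.
Qed.

Lemma qpowD q z w : qpow q (z + w) = qpow q z * qpow q w.
Proof. by rewrite /qpow; case: xgetP => [f _ []//|]; rewrite mulr1. Qed.

Definition qpow_ker q : {pred Zhat} := fun z => qpow q z == 1.

Lemma qpow_ker_zmod_closed q : zmod_closed (qpow_ker q).
Proof.
split=> [|z w]; rewrite /qpow_ker !unfold_in ?qpow0 //.
move=> /eqP z1 /eqP w1; have := qpowD q (z - w) w.
by rewrite subrK z1 w1 mulr1 => <-.
Qed.
HB.instance Definition _ q :=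
  GRing.isZmodClosed.Build Zhat (qpow_ker q) (qpow_ker_zmod_closed q).

(* Zhat / ker (z |-> q^z); this is C_q for q <> 1 *)
Definition Zhat_quot q := quotient_topology (Quotient.quot (qpow_ker q)).
HB.instance Definition _ q := GRing.Zmodule.copy (Zhat_quot q)
  (Quotient.quot (qpow_ker q)).
HB.instance Definition _ q := Topological.on (Zhat_quot q).
HB.instance Definition _ q := Quotient.on (Zhat_quot q).

End PadicRing.
Arguments padic_dist {p p_pr} R x y.

Section CqDef.
Variables (p : nat) (p_pr : prime p) (q : padic_int p_pr).
Local Notation Zp := (padic_int p_pr).
Local Open Scope quotient_scope.

(* q^c for c in Zhat / ker (z |-> q^z) *)
Definition quot_qpow (c : Zhat_quot q) : Zp := qpow q (repr c).

(* the continuous 1-cocycle with value 1 at 1, for the action c * a = q^c a; it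
   exists for q <> 1 (iota_quotP) and is (q^c - 1) / (q - 1) (iota_quotE) *)
Definition is_iota (f : Zhat_quot q -> Zp) :=
  [/\ continuous f, forall c d, f (c + d) = f c + quot_qpow c * f d
    & f (\pi 1) = 1].

Definition iota_quot : Zhat_quot q -> Zp := xget (fun=> 0) is_iota.

(* C_q, with the conventions C_1 = Z_p and iota_1 = id *)
Definition Cq_case (is_one : bool) : topologicalType :=
  if is_one then Zp : topologicalType else Zhat_quot q : topologicalType.
Definition Cq : topologicalType := Cq_case (q == 1).

Definition toCq : Zhat -> Cq :=
  if q == 1 as b return Zhat -> Cq_case b
  then @Zhat_Zp p p_pr else \pi_(Zhat_quot q).

Definition iota_q : Cq -> Zp :=
  if q == 1 as b return Cq_case b -> Zp then id else iota_quot.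

(* "C_q = Z_p": as quotients of Zhat, z in Z_p being identified with the class
   in C_q of any element of Zhat that projects to z; such elements exist
   (Zhat_Zp_surj) *)
Definition Cq_is_Zp : Prop :=
  forall z w : Zhat, toCq z = toCq w <-> Zhat_Zp p_pr z = Zhat_Zp p_pr w.

End CqDef.
Arguments toCq {p p_pr} q z.
Arguments iota_q {p p_pr} q c : rename.

Section Metric.
Variables (R : realType).

Definition is_metric (T : Type) (d : T -> T -> R) : Prop :=
  [/\ forall x y, 0 <= d x y, forall x y, d x y = 0 <-> x = y,
      forall x y, d x y = d y x & forall x y z, d x z <= d x y + d y z].

Definition induces_topology (T : topologicalType) (d : T -> T -> R) : Prop :=
  forall (x : T) (A : set T),
    nbhs x A <-> exists2 e : R, 0 < e & [set y | d x y < e] `<=` A.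

Definition is_isometry (S T : Type) (dS : S -> S -> R) (dT : T -> T -> R)
    (f : S -> T) : Prop :=
  (forall y, exists x, f x = y) /\ forall x y, dT (f x) (f y) = dS x y.

(* the metrics considered on C_q: the p-adic one if C_q = Z_p, otherwise any one
   inducing the topology *)
Definition Cq_metric p (p_pr : prime p) (q : padic_int p_pr)
    (d : Cq q -> Cq q -> R) : Prop :=
  (Cq_is_Zp q -> forall z w : Zhat,
     d (toCq q z) (toCq q w) = padic_dist R (Zhat_Zp p_pr z) (Zhat_Zp p_pr w)) /\
  (~ Cq_is_Zp q -> is_metric d /\ induces_topology d).

End Metric.

Lemma adic_cvgP N (F : set_system (adic N)) (FF : Filter F) (x : adic N) :
  F --> x <-> forall i, F [set y | y i = x i].
Proof.
split=> [Fx i|Fx A].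
  apply: Fx; apply: open_nbhs_nbhs; split=> //.
  exists [set f | f i = x i]; last by [].
  pose K := fun _ : nat => discrete_topology int.
  rewrite openE => f fi; apply: (@proj_continuous _ K i f [set y | y = x i]).
  by rewrite nbhs_principalE; apply/principal_filterP.
rewrite nbhsE => -[_ [[B oB <-] Bx] BA].
suff : @residues N @ F --> residues x.
  have nB : nbhs (residues x) B by rewrite nbhsE; exists B.
  by move=> /(_ B nB) FB; apply: (filterS BA); exact: FB.
apply/cvg_sup => i U [_ [[W _ <-] Wx] WU].
by apply: filterS (Fx i) => y yx; apply: WU; rewrite /= /proj /= yx.
Qed.

Lemma near_residue N (x : adic N) i : nbhs x [set y : adic N | y i = x i].
Proof. by move: i; apply/adic_cvgP. Qed.

Lemma residue_natr N n i : (n%:R : adic N) i = (n%:Z %% (N i)%:Z)%Z.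
Proof.
elim: n => [|n IHn]; first by rewrite /= mod0z.
by rewrite mulrS [LHS]/= IHn modzDml modzDmr -intS.
Qed.

Lemma residueX N (x : adic N) n i : (x ^+ n) i = (x i ^+ n %% (N i)%:Z)%Z.
Proof.
elim: n => [|n IHn]; first by rewrite !expr0.
by rewrite !exprS /= IHn modzMmr.
Qed.

Lemma Zhat_natr_residue (z : Zhat) m : (`|z m|%:R : Zhat) m = z m.
Proof.
rewrite residue_natr gez0_abs ?residue_mod //.
by rewrite -(residue_mod z) modz_ge0.
Qed.

Lemma Zhat_nbhs (z : Zhat) (A : set Zhat) :
  nbhs z A -> exists m, forall y : Zhat, y m = z m -> A y.
Proof.
pose F : set_system Zhat :=
  filter_from [set: nat] (fun m => [set y : Zhat | y m = z m]).
have dvdr i m (y : Zhat) : (i.+1 %| m.+1)%N -> y m = z m -> y i = z i.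
  by move=> im ym; rewrite -(residueP y im) ym (residueP z im).
have FF : Filter F.
  apply: filter_from_filter; first by exists 0%N.
  move=> i j _ _; exists (i.+1 * j.+1).-1 => // y ym.
  by split; apply: dvdr ym; rewrite prednK ?muln_gt0 //; [exact: dvdn_mulr|exact: dvdn_mull].
have Fz : F --> z by apply/adic_cvgP => i; exists i.
by move=> /Fz[m _ mA]; exists m => y /mA.
Qed.

Section PadicExistence.
Variables (p : nat) (p_pr : prime p).
Local Notation Zp := (padic_int p_pr).
Implicit Types q x : Zp.

Lemma Zhat_continuous_eq (f g : Zhat -> Zp) : continuous f -> continuous g ->
  (forall n, f n%:R = g n%:R) -> f =1 g.
Proof.
move=> fc gc fg z; apply/adicP => k.
have := @filterI _ _ (nbhs_filter z) _ _
  (fc z _ (near_residue (f z) k)) (gc z _ (near_residue (g z) k)).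
move=> /Zhat_nbhs[m /(_ _ (Zhat_natr_residue z m))[/= <- <-]].
by rewrite fg.
Qed.

Lemma padic_continuous (f : Zhat -> Zp) (M : nat -> nat) :
  (forall k (z w : Zhat), z (M k) = w (M k) -> f z k = f w k) -> continuous f.
Proof.
move=> fM z; have FF : Filter (nbhs (f @ z)) by apply: fmap_filter; exact: nbhs_filter.
apply/(adic_cvgP FF) => k.
by apply: filterS (near_residue z (M k)) => w zw; exact: fM.
Qed.

Lemma is_qpow_natr q f : is_qpow q f -> forall n, f n%:R = q ^+ n.
Proof.
move=> [_ fU fD f1]; elim=> [|n IHn].
  by apply: (mulrI (fU 0)); rewrite -fD addr0 mulr1.
by rewrite mulrS fD f1 IHn exprS.
Qed.

Lemma is_qpow_unique q f g : is_qpow q f -> is_qpow q g -> f = g.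
Proof.
move=> fq gq; apply/funext; apply: Zhat_continuous_eq; [by case: fq|by case: gq|].
by move=> n; rewrite !(is_qpow_natr fq, is_qpow_natr gq).
Qed.

Section Unit.
Variables (q : Zp) (q_unit : q \is a GRing.unit).

Let tot k := (p.-1 * p ^ k)%N.
Let pk_gt0 k : (0 < p ^ k)%N. Proof. by rewrite expn_gt0 prime_gt0. Qed.
Let tot_gt0 k : (0 < tot k)%N.
Proof. by rewrite muln_gt0 pk_gt0 -subn1 subn_gt0 prime_gt1. Qed.
Let tot_dvd i j : (p ^ i %| p ^ j)%N -> (tot i %| tot j)%N.
Proof. exact: dvdn_mul. Qed.

Let qX_tot k : (q ^+ tot k) k = (1 : Zp) k.
Proof.
rewrite residueX /=.
have qk_ge0 : 0 <= q k.
  by rewrite -(residue_mod q) modz_ge0 // eqz_nat -lt0n.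
rewrite -(gez0_abs qk_ge0) -[X in X ^+ _]natz -natrX natz !modz_nat.
congr (_%:Z).
have [a ->] : exists a, tot k = (totient (p ^ k) * a)%N.
  case: k {qk_ge0} => [|k]; first by exists (tot 0); rewrite expn0 mul1n.
  by exists p; rewrite totient_pfactor // /tot expnSr mulnA.
rewrite expnM -modnXm -[in RHS](exp1n a) -[in RHS]modnXm; congr (_ ^ _ %% _)%N.
apply: cyclic.Euler_exp_totient.
suff : coprimez (q k) (p ^ k)%N by [].
have /(congr1 (fun x : Zp => residue x k)) /= := mulVr q_unit.
move=> /eqP; rewrite eqz_mod_dvd => /dvdzP[c cE].
apply/coprimezP; exists (q^-1 k, - c) => /=.
by rewrite mulNr -cE opprB addrC subrK.
Qed.

Let eq_residueM k (x y x' y' : Zp) :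
  x k = x' k -> y k = y' k -> (x * y) k = (x' * y') k.
Proof. by move=> /= -> ->. Qed.

Let eq_residueD k (x y x' y' : Zp) :
  x k = x' k -> y k = y' k -> (x + y) k = (x' + y') k.
Proof. by move=> /= -> ->. Qed.

Let qXtot_mul k a : (q ^+ (a * tot k)) k = (1 : Zp) k.
Proof.
elim: a => [|a IHa]; first by rewrite mul0n.
by rewrite mulSn exprD -[in RHS](mulr1 1); exact: eq_residueM.
Qed.

Let qX_mod k m n : (m = n %[mod tot k])%N -> (q ^+ m) k = (q ^+ n) k.
Proof.
have red m' : (q ^+ m') k = (q ^+ (m' %% tot k)) k.
  rewrite {1}(divn_eq m' (tot k)) exprD -[in RHS](mul1r (q ^+ _)).
  exact: eq_residueM.
by move=> mn; rewrite red mn -red.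
Qed.

Let Zres_mod (z : Zhat) n m : (0 < n)%N -> (0 < m)%N -> (n %| m)%N ->
  (`|z m.-1| = `|z n.-1| %[mod n])%N.
Proof.
move=> n0 m0 nm; have z_ge0 i : 0 <= z i by rewrite -(residue_mod z) modz_ge0.
have := @residueP _ z n.-1 m.-1; rewrite !prednK // => /(_ nm).
rewrite -[in LHS](gez0_abs (z_ge0 m.-1)) -[in RHS](gez0_abs (z_ge0 n.-1)).
by rewrite modz_nat => -[<-]; rewrite modn_mod.
Qed.

Let Zres_modD (z w : Zhat) n : (0 < n)%N ->
  (`|(z + w)%R n.-1| = `|z n.-1| + `|w n.-1| %[mod n])%N.
Proof.
move=> n0; have z_ge0 (u : Zhat) i : 0 <= u i by rewrite -(residue_mod u) modz_ge0.
rewrite /= prednK // -(gez0_abs (z_ge0 z n.-1)) -(gez0_abs (z_ge0 w n.-1)).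
by rewrite -PoszD modz_nat /= modn_mod.
Qed.

Let qf_compat (z : Zhat) :
  adic_compat (expn p) (fun k => (q ^+ `|z (tot k).-1|) k).
Proof.
move=> i j ij; rewrite (residueP (q ^+ `|z (tot j).-1|) ij); apply: qX_mod.
by apply: Zres_mod => //; exact: tot_dvd.
Qed.
Let qf z : Zp := mk_adic (qf_compat z).

Let qf_is_qpow : is_qpow q qf.
Proof.
split.
- by apply: (@padic_continuous _ (fun k => (tot k).-1)) => k z w /= ->.
- have qfD z w : qf (z + w) = qf z * qf w.
    apply/adicP => k; rewrite -[LHS]/((q ^+ _) k) (qX_mod (Zres_modD z w _)) //.
    by rewrite exprD.
  have qf0 : qf 0 = 1.
    apply/adicP => k; rewrite -[LHS]/((q ^+ _) k).
    by have -> : (0 : Zhat) (tot k).-1 = 0 by rewrite /= mod0z.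
  move=> z; apply/asboolP; exists (qf (- z)).
  by rewrite -qfD addNr qf0.
- move=> z w; apply/adicP => k.
  by rewrite -[LHS]/((q ^+ _) k) (qX_mod (Zres_modD z w _)) // exprD.
- apply/adicP => k; rewrite -[LHS]/((q ^+ _) k) -[in RHS](expr1 q).
  by apply: qX_mod; rewrite /= prednK // modz_nat /= modn_mod.
Qed.

Lemma qpowP : is_qpow q (qpow q).
Proof. by rewrite /qpow; case: xgetP => // /(_ qf); case. Qed.

Let S m : Zp := \sum_(i < m) q ^+ i.

Let SD m n : S (m + n) = S m + q ^+ m * S n.
Proof.
rewrite /S big_split_ord /= mulr_sumr; congr (_ + _).
by apply: eq_bigr => i _; rewrite exprD.
Qed.

Let per k := (p ^ k * tot k)%N.
Let per_gt0 k : (0 < per k)%N. Proof. by rewrite muln_gt0 pk_gt0 tot_gt0. Qed.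

Let S_per k a : S (a * per k) k = (0 : Zp) k.
Proof.
have Stot b : S (b * tot k) k = (b%:R * S (tot k)) k.
  elim: b => [|b IHb]; first by rewrite mul0n mul0r /S big_ord0.
  rewrite mulSn SD mulrS mulrDl mul1r; apply: eq_residueD => //.
  rewrite -[in RHS](mul1r (b%:R * _)); exact: eq_residueM.
rewrite /per mulnA Stot -(mul0r (S (tot k))); apply: eq_residueM => //.
by rewrite residue_natr PoszM modzMl /= mod0z.
Qed.

Let S_mod k m n : (m = n %[mod per k])%N -> S m k = S n k.
Proof.
have red m' : S m' k = S (m' %% per k) k.
  rewrite {1}(divn_eq m' (per k)) SD -[in RHS](add0r (S _)).
  apply: eq_residueD; first exact: S_per.
  rewrite -[in RHS](mul1r (S _)); apply: eq_residueM => //.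
  by rewrite /per mulnA qXtot_mul.
by move=> mn; rewrite red mn -red.
Qed.

Let ih_compat (z : Zhat) :
  adic_compat (expn p) (fun k => S `|z (per k).-1| k).
Proof.
move=> i j ij; rewrite (residueP (S _) ij); apply: S_mod.
by apply: Zres_mod => //; apply: dvdn_mul => //; exact: tot_dvd.
Qed.
Let ih z : Zp := mk_adic (ih_compat z).

Let qpow_per z k : qpow q z k = (q ^+ `|z (per k).-1|) k.
Proof.
rewrite (is_qpow_unique qpowP qf_is_qpow) -[LHS]/((q ^+ _) k); apply: qX_mod.
by apply/esym/Zres_mod => //; exact: dvdn_mull.
Qed.

Let ihD z w : ih (z + w) = ih z + qpow q z * ih w.
Proof.
apply/adicP => k; rewrite -[LHS]/(S _ k) (S_mod (Zres_modD z w _)) // SD.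
by apply: eq_residueD => //; apply: eq_residueM => //; rewrite qpow_per.
Qed.

Let ih1 : ih 1 = 1.
Proof.
apply/adicP => k; rewrite -[LHS]/(S _ k).
have -> : S `|(1 : Zhat) (per k).-1| k = S 1 k.
  by apply: S_mod; rewrite /= prednK // modz_nat /= modn_mod.
by rewrite /S big_ord1 expr0.
Qed.

Let ih_continuous : continuous ih.
Proof. by apply: (@padic_continuous _ (fun k => (per k).-1)) => k z w /= ->. Qed.

Section Quotient.
Local Open Scope quotient_scope.

Lemma pi_qpow (z w : Zhat) :
  \pi_(Zhat_quot q) z = \pi_(Zhat_quot q) w <-> qpow q z = qpow q w.
Proof.
have -> : (\pi_(Zhat_quot q) z = \pi_(Zhat_quot q) w) <->
    qpow q (z - w) = 1.
  split=> [/eqP zw|zw].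
    by apply/eqP; have := zw; rewrite -Quotient.idealrBE.
  by apply/eqP; rewrite -Quotient.idealrBE; apply/eqP.
have [_ qU _ _] := qpowP.
have := qpowD q (z - w) w; rewrite subrK => ->.
split=> [->|/(canRL (mulrK (qU w))) ->]; by rewrite ?mul1r ?mulrV.
Qed.

Lemma quot_qpowE z : quot_qpow (\pi_(Zhat_quot q) z) = qpow q z.
Proof. by apply/pi_qpow; rewrite reprK. Qed.

Hypothesis q_neq1 : q != 1.

Let ih_qpow z : ih z * (q - 1) = qpow q z - 1.
Proof.
have := ihD 1 z; rewrite [1 + z]addrC ihD ih1.
have [_ _ _ ->] := qpowP; rewrite mulr1 => /eqP.
rewrite addrC eq_sym -subr_eq => /eqP h.
by rewrite mulrBr mulr1 mulrC; apply/eqP; rewrite subr_eq -h; apply/eqP; ring.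
Qed.

Lemma iota_quotP : is_iota (@iota_quot p p_pr q).
Proof.
rewrite /iota_quot; case: xgetP => // /(_ (ih \o repr)); case.
have ih_pi z w : \pi_(Zhat_quot q) z = \pi_(Zhat_quot q) w -> ih z = ih w.
  move=> /pi_qpow zw; have q10 : q - 1 != 0 by rewrite subr_eq0.
  by apply: (mulIf q10); rewrite !ih_qpow zw.
split.
- apply: repr_comp_continuous; first exact: ih_continuous.
  by move=> z w /eqP zw; apply/eqP; exact: ih_pi.
- move=> c d /=; rewrite -ihD; apply: ih_pi.
  by rewrite reprK raddfD /= !reprK.
- by rewrite -ih1; apply: ih_pi; rewrite reprK.
Qed.

Lemma iota_quotE z :
  iota_quot (\pi_(Zhat_quot q) z) * (q - 1) = qpow q z - 1.
Proof.
have [_ fD f1] := iota_quotP; set c := \pi z.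
have := fD c (\pi 1); rewrite addrC fD f1 !quot_qpowE.
have [_ _ _ ->] := qpowP; rewrite mulr1 => h.
by apply/eqP; rewrite mulrBr mulr1 subr_eq mulrC -subr_eq0; apply/eqP;
  move/eqP: h; rewrite addrC -subr_eq0 => /eqP <-; ring.
Qed.

End Quotient.
End Unit.
End PadicExistence.

Lemma Zhat_Zp_surj p (p_pr : prime p) (a : padic_int p_pr) :
  exists z : Zhat, Zhat_Zp p_pr z = a.
Proof.
pose k n := logn p n; pose r n := (n`_(p^'))%N.
pose e n := (r n ^ totient (p ^ k n))%N.
pose f i : int := a (k i.+1) * (e i.+1)%:Z.
have tot_gt0 n : (0 < totient (p ^ k n))%N.
  by rewrite totient_gt0 expn_gt0 prime_gt0.
have re n : (r n %| e n)%N by rewrite /e -(prednK (tot_gt0 n)) expnS dvdn_mulr.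
have aE n m : (n %| m)%N -> (0 < m)%N ->
    (a (k m) * (e m)%:Z = a (k n) %[mod (p ^ k n)%N])%Z.
  move=> nm m0; have kk : (p ^ k n %| p ^ k m)%N.
    by apply: dvdn_exp2l; exact: dvdn_leq_log.
  have e1 : (e m = 1 %[mod p ^ k n])%N.
    have : (e m = 1 %[mod p ^ k m])%N.
      by apply: cyclic.Euler_exp_totient; rewrite /k /r coprime_sym -p_part; exact: coprime_partC.
    by rewrite -(modn_dvdm (e m) kk) => ->; rewrite modn_dvdm.
  by rewrite -modzMmr modz_nat e1 -modz_nat modzMmr mulr1 -(residueP a kk) modz_mod.
have fP i j : (i.+1 %| j.+1)%N -> (f j = f i %[mod i.+1%:Z])%Z.
  move=> ij; apply/eqP; rewrite eqz_mod_dvd -(partnC p (ltn0Sn i)) PoszM.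
  rewrite Gauss_dvdz; last by rewrite /coprimez /=; exact: coprime_partC.
  apply/andP; split.
    by rewrite p_part -eqz_mod_dvd /f aE // aE.
  rewrite rpredB //; apply: dvdz_mull; rewrite dvdzE /=; last exact: re.
  by apply: dvdn_trans (re _); exact: partn_dvd.
exists (reduce fP); apply/adicP => m /=.
have pm0 : (0 < p ^ m)%N by rewrite expn_gt0 prime_gt0.
have km : k (p ^ m)%N = m by rewrite /k pfactorK.
have := aE _ _ (dvdnn (p ^ m)) pm0; rewrite km residue_mod => <-.
by rewrite /f prednK // km.
Qed.

(* Main.v *)
(* Write S n = 1 + q + ... + q^(n-1). By density of the integers in Zhat, iota_q
   is determined by iota_q(n) = S n. When q is in U^(1) for p odd, or in U^(2)
   for p = 2, the powers p^k dividing S n are those dividing n (lifting the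
   exponent). As S n - S m = q^m S (n - m), the residue of iota_q(z) modulo p^k
   then determines, and is determined by, that of z: this gives the isometry and
   the valuation at once, and surjectivity by counting residues.
   Conversely, for any metric an isometry is surjective, so S takes every value
   modulo p and modulo 4. If q <> 1 mod p, the value -1 / (q - 1) would give
   q^n = 0 mod p; if p = 2 and q = 3 mod 4, S is 0 or 1 modulo 4. *)
Require Import Defs.
From mathcomp Require Import all_boot all_order all_algebra.
From mathcomp Require Import all_classical all_reals all_analysis.
From mathcomp Require Import zify.

Set Implicit Arguments.
Unset Strict Implicit.
Unset Printing Implicit Defensive.

Import Order.TTheory GRing.Theory Num.Theory.

Local Open Scope ring_scope.

(** * Congruences of geometric sums *)

Section GeometricSum.
Local Open Scope nat_scope.

Definition geom (Q n : nat) := \sum_(i < n) Q ^ i.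

Lemma geomD Q m n : geom Q (m + n) = geom Q m + Q ^ m * geom Q n.
Proof.
rewrite /geom big_split_ord big_distrr /=; congr (_ + _).
by apply: eq_bigr => i _; rewrite -expnD.
Qed.

Lemma geomS Q n : geom Q n.+1 = 1 + Q * geom Q n.
Proof. by rewrite -add1n geomD /geom big_ord1. Qed.

(** Group the terms into [n] blocks of length [m]. With [m = p] this splits one factor [p] off the
    length at the cost of replacing [Q] by [Q ^ p]. *)
Lemma geomM Q m n : geom Q (m * n) = geom Q m * geom (Q ^ m) n.
Proof.
elim: n => [|n IHn]; first by rewrite /geom muln0 !big_ord0 muln0.
by rewrite mulnS geomD IHn geomS mulnDr muln1 mulnCA.
Qed.

Lemma geom_gt0 Q n : 0 < n -> 0 < geom Q n.
Proof. by case: n => // n _; rewrite geomS. Qed.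

Lemma eq_geom_mod m Q Q' n : Q = Q' %[mod m] -> geom Q n = geom Q' n %[mod m].
Proof.
move=> QQ'; elim: n => [|n IHn]; first by rewrite /geom !big_ord0.
by rewrite !geomS -modnDmr -modnMm QQ' IHn modnMm modnDmr.
Qed.

Lemma geom_mod m Q n : Q = 1 %[mod m] -> geom Q n = n %[mod m].
Proof.
move=> /eq_geom_mod ->; rewrite /geom (eq_bigr (fun=> 1)) ?sum1_card ?card_ord //.
by move=> i _; rewrite exp1n.
Qed.

Lemma expn_mod1 m Q n : Q = 1 %[mod m] -> Q ^ n = 1 %[mod m].
Proof. by move=> Q1; rewrite -modnXm Q1 modnXm exp1n. Qed.

(** * Lifting the exponent at a prime *)

Section Valuation.
Variables (p : nat) (p_pr : prime p).

(* (1 + p a)^i = 1 + i p a modulo p^2, and p divides the sum of the i < p *)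
Lemma geom_prime_odd Q : odd p -> Q = 1 %[mod p] -> geom Q p = p %[mod p ^ 2].
Proof.
move=> podd Q1.
have [a ->] : exists a, Q = a * p + 1.
  by exists (Q %/ p); rewrite {1}(divn_eq Q p) Q1 modn_small ?prime_gt1.
have X i : (a * p + 1) ^ i = 1 + i * (a * p) %[mod p ^ 2].
  elim: i => // i IHi; rewrite expnS -modnMmr IHi modnMmr.
  have -> : (a * p + 1) * (1 + i * (a * p)) =
            i * a ^ 2 * p ^ 2 + (1 + i.+1 * (a * p)) by rewrite -!mulnn; lia.
  by rewrite modnMDl.
rewrite /geom -modn_summ (eq_bigr _ (fun i _ => X (val i))) modn_summ.
rewrite big_split /= sum1_card card_ord -big_distrl /= -(big_mkord xpredT id).
rewrite bin2_sum bin2odd // addnC.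
have -> : p * p.-1./2 * (a * p) = p.-1./2 * a * p ^ 2 by rewrite -mulnn; lia.
by rewrite modnMDl.
Qed.

(** Strong induction on [n]. If [p] does not divide [n], the sum is [n] modulo [p], hence prime to
    [p]. If [n = k * p], the factor [geom Q p] is [p] modulo [p ^ 2], so has valuation exactly 1,
    and the induction applies to [Q ^ p] and [k]. *)
Lemma logn_geom Q n : Q = 1 %[mod p] -> (p = 2 -> Q = 1 %[mod 4]) -> 0 < n ->
  logn p (geom Q n) = logn p n.
Proof.
move=> Q1 Q4; have [m] := ubnP n; elim: m => // m IHm in Q n Q1 Q4 * => nm n0.
have [/dvdnP[k nE]|pn] := boolP (p %| n); last first.
  by rewrite !logn_coprime ?prime_coprime // /dvdn (geom_mod n Q1).
have k0 : 0 < k by move: n0; rewrite nE muln_gt0 => /andP[].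
have p1 := prime_gt1 p_pr.
rewrite nE mulnC geomM !lognM ?geom_gt0 ?(ltnW p1) //; congr (_ + _); last first.
  apply: IHm => //; first exact: expn_mod1.
    by move=> /Q4; exact: expn_mod1.
  by rewrite -ltnS; apply: leq_trans nm; rewrite nE ltnS -[X in X < _]muln1 ltn_pmul2l.
have -> : logn p p = 1 by rewrite logn_prime ?eqxx.
have g2 : geom Q p = p %[mod p ^ 2].
  have [podd|peven] := boolP (odd p); first exact: geom_prime_odd.
  case: (even_prime p_pr) => [p2|]; last by rewrite (negPf peven).
  (* For [p = 2] the modulus [p ^ 2] is 4, so the congruence modulo 4 suffices. *)
  by move: p2 (Q4 p2) => ->; exact: geom_mod.
have gp : 0 < geom Q p by rewrite geom_gt0 ?prime_gt0.
apply/eqP; rewrite eqn_leq -{2}(expn1 p) -pfactor_dvdn // leqNgt -pfactor_dvdn //.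
rewrite !/dvdn g2 expn1 (geom_mod p Q1) modnn eqxx andbT.
by rewrite modn_small -?lt0n ?prime_gt0 // -{1}(expn1 p) ltn_exp2l.
Qed.

Lemma dvdn_geom Q n k : Q = 1 %[mod p] -> (p = 2 -> Q = 1 %[mod 4]) ->
  (p ^ k %| geom Q n) = (p ^ k %| n).
Proof.
move=> Q1 Q4; case: (posnP n) => [->|n0]; first by rewrite /geom big_ord0.
by rewrite !pfactor_dvdn ?geom_gt0 // logn_geom.
Qed.

(** The difference of the two sums is [Q ^ m * geom Q (n - m)] for [m <= n], and [Q ^ m] is prime to
    [p]. *)
Lemma eq_geom Q m n k : Q = 1 %[mod p] -> (p = 2 -> Q = 1 %[mod 4]) ->
  (geom Q m == geom Q n %[mod p ^ k]) = (m == n %[mod p ^ k]).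
Proof.
move=> Q1 Q4; wlog mn : m n / m <= n => [W|].
  by case: (leqP m n) => [|/ltnW] /W // E; rewrite eq_sym E eq_sym.
have cop : coprime (p ^ k) (Q ^ m).
  rewrite coprimeXl // coprimeXr //.
  by rewrite -coprime_modr Q1 coprime_modr coprimen1.
rewrite [LHS]eq_sym [RHS]eq_sym -(subnKC mn) geomD !eqn_mod_dvd ?leq_addr //.
by rewrite !addKn Gauss_dvdr // dvdn_geom.
Qed.

(* a sum equal to -1 / (Q - 1) modulo p would give Q^n = 0 modulo p *)
Lemma geom_surj_mod Q : ~~ (p %| Q) ->
  (forall c, exists n, geom Q n = c %[mod p]) -> Q = 1 %[mod p].
Proof.
move=> pQ sj; apply/eqP/negPn/negP => Q1.
have FE m n : (m%:R == n%:R :> 'F_p)%R = (m == n %[mod p]).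
  by rewrite -val_eqE /= !val_Fp_nat.
have x1 : ((Q%:R : 'F_p) - 1 != 0)%R by rewrite subr_eq0 -[1%R]/(1%:R)%R FE.
have x0 : ((Q%:R : 'F_p) != 0)%R by rewrite -[0%R]/(0%:R)%R FE mod0n.
have [n /eqP] := sj (- ((Q%:R : 'F_p) - 1)^-1)%R.
rewrite -FE natr_Zp => /eqP gE.
have : ((Q%:R : 'F_p) ^+ n == 0)%R.
  rewrite -(subrK 1%R (_ ^+ n)%R) subrX1.
  have -> : (\sum_(i < n) (Q%:R : 'F_p) ^+ i = (geom Q n)%:R)%R.
    by rewrite natr_sum; apply: eq_bigr => i _; rewrite natrX.
  by rewrite gE mulrN divff // addNr.
by rewrite expf_eq0 (negPf x0) andbF.
Qed.

End Valuation.

(** The sums alternate between 0 and 1 modulo 4, since [1 + 3 * 1] is 0. *)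
Lemma geom_mod4 Q n : Q = 3 %[mod 4] -> geom Q n <> 2 %[mod 4].
Proof.
move=> Q3; suff : geom Q n %% 4 = odd n by case: (odd n) => ->.
elim: n => [|n IHn]; first by rewrite /geom big_ord0.
by rewrite geomS -modnDmr -modnMm Q3 IHn /=; case: (odd n).
Qed.

End GeometricSum.

(** * Residues, valuation and distance in the p-adic integers *)

Section Padic.
Local Open Scope classical_set_scope.
Local Open Scope quotient_scope.
Variables (p : nat) (p_pr : prime p).
Local Notation Zp := (padic_int p_pr).
Implicit Types (q x y : Zp) (z w : Zhat).

Lemma expp_gt0 k : (0 < p ^ k)%N.
Proof. by rewrite expn_gt0 prime_gt0. Qed.

Lemma residue_ge0 x k : 0 <= x k.
Proof. by rewrite -(residue_mod x) modz_ge0 // eqz_nat -lt0n expp_gt0. Qed.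

Lemma residue_nat x k : x k = (`|x k| %% p ^ k)%N.
Proof. by rewrite -modz_nat gez0_abs ?residue_ge0 // residue_mod. Qed.

Lemma padic_natr n k : (n%:R : Zp) k = (n %% p ^ k)%N.
Proof. by rewrite (residue_natr (expn p)) modz_nat. Qed.

Lemma eq_residue_le x y (i j : nat) : (i <= j)%N -> x j = y j -> x i = y i.
Proof. by move=> ij xy; rewrite -(padic_residue_lt x ij) xy padic_residue_lt. Qed.

Lemma padic_dvdP k x : padic_dvd k x <-> x k = 0.
Proof.
split=> [[y ->]|xk].
  by rewrite -natrX [LHS]/= (residue_natr (expn p)) modzz mul0r mod0z.
have pk0 : (p ^ k)%N%:Z != 0 by rewrite eqz_nat -lt0n expp_gt0.
have dv i : (((p ^ k)%N%:Z) %| x (i + k)%N)%Z.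
  by apply/dvdz_mod0P; rewrite padic_residue_lt ?leq_addl.
(* The quotient modulo [p ^ i] must be read off the residue of [x] at level [i + k], as dividing by
   [p ^ k] loses [k] levels. *)
have yP : adic_compat (expn p) (fun i => (x (i + k)%N %/ (p ^ k)%N%:Z)%Z).
  move=> i j ij; apply: (mulIf pk0).
  rewrite divzK // mulz_modl ?ltz_nat ?expp_gt0 // divzK // -PoszM -expnD.
  by apply: (residueP x); rewrite !expnD dvdn_mul.
exists (mk_adic yP); apply/adicP => i; rewrite -natrX [RHS]/=.
rewrite (residue_natr (expn p)) modzMml mulrC divzK //.
by rewrite padic_residue_lt ?leq_addr.
Qed.

Lemma subr_residue x y k : (x - y) k = 0 <-> x k = y k.
Proof.
rewrite [(x - y) k]/= modzDmr; split=> [/dvdz_mod0P|->]; last by rewrite subrr mod0z.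
by rewrite -eqz_mod_dvd => /eqP; rewrite !residue_mod.
Qed.

Lemma padic_UP m q : padic_U m q <-> q m = (1 : Zp) m.
Proof.
rewrite -subr_residue -padic_dvdP.
by split=> -[a aE]; exists a; [rewrite aE addrC addKr|rewrite -aE addrC subrK].
Qed.

Lemma eq_vp x y : (forall k, x k = 0 <-> y k = 0) -> vp x = vp y.
Proof.
(* [vp] depends on a proof of existence; abstracting the predicate into [f] lets it be replaced by
   an equal one. *)
move=> xy; pose f (P : pred nat) :=
  if pselect (exists k, P k) is left h then Some (ex_minn h) else None.
rewrite -[vp x]/(f _) -[vp y]/(f _); congr f; apply/funext => k.
by congr (~~ _); apply: asbool_equiv_eq; rewrite !padic_dvdP.
Qed.

(** Reduces preservation of distances to a comparison of congruences at every level. *)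
Lemma eq_padic_dist (R : realType) x y x' y' :
  (forall k, x k = y k <-> x' k = y' k) -> padic_dist R x y = padic_dist R x' y'.
Proof.
move=> xy; rewrite /padic_dist /padic_norm (@eq_vp _ (x' - y')) // => k.
by rewrite !subr_residue.
Qed.

Lemma continuous_Zhat_Zp : continuous (Zhat_Zp p_pr).
Proof. by apply: (padic_continuous (M := fun k => (p ^ k).-1)) => k z w /= ->. Qed.

Lemma Zhat_Zp_natr n : Zhat_Zp p_pr n%:R = n%:R.
Proof.
apply/adicP => k; rewrite padic_natr -modz_nat.
by rewrite [LHS]/= residue_natr prednK ?expp_gt0.
Qed.

(** Density of the natural numbers in [Zhat], with a single [n] serving both [f] and the projection
    to [Z_p]. *)
Lemma Zhat_approx (f : Zhat -> Zp) z k : continuous f ->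
  exists n, f z k = f n%:R k /\ Zhat_Zp p_pr z k = (n%:R : Zp) k.
Proof.
move=> fc; have := @filterI _ _ (nbhs_filter z) _ _
  (fc z _ (near_residue (f z) k))
  (continuous_Zhat_Zp (near_residue (Zhat_Zp p_pr z) k)).
move=> /Zhat_nbhs[m /(_ _ (Zhat_natr_residue z m))[/= <- <-]].
by exists `|z m|%N; rewrite -Zhat_Zp_natr.
Qed.

Lemma residue_natr_abs x (i j : nat) : (i <= j)%N -> x i = (`|x j|%:R : Zp) i.
Proof.
by move=> ij; apply: (eq_residue_le ij); rewrite padic_natr -residue_nat.
Qed.

Lemma residue_sum_exp q (Q n k : nat) : q k = (Q%:R : Zp) k ->
  (\sum_(i < n) q ^+ i) k = ((geom Q n)%:R : Zp) k.
Proof.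
move=> qQ; rewrite /geom natr_sum.
apply: (big_ind2 (fun x y => x k = y k)) => [//|x x' y y' /= -> -> //|i _].
rewrite natrX; elim: (i : nat) => [//|j IHj].
by rewrite !exprS; move: qQ IHj => /= -> ->.
Qed.

(** * The cocycle pulled back to [Zhat] *)

Section Iota.
Variables (q : Zp) (q_unit : q \is a GRing.unit).

Lemma toCq_surj (c : Cq q) : exists z, toCq q z = c.
Proof.
move: c; rewrite /toCq /Cq; case: (q == 1) => /= c; first exact: Zhat_Zp_surj.
by exists (repr c); rewrite reprK.
Qed.

Lemma iota_toCqE z : iota_q q (toCq q z) =
  if q == 1 then Zhat_Zp p_pr z else iota_quot (\pi_(Zhat_quot q) z).
Proof. by rewrite /iota_q /toCq; case: (q == 1). Qed.

(** For [q != 1], the value of the cocycle determines [q^z], hence the class of [z] modulo the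
    kernel. *)
Lemma toCq_inj z w : iota_q q (toCq q z) = iota_q q (toCq q w) ->
  toCq q z = toCq q w.
Proof.
rewrite !iota_toCqE /toCq.
have : q != 1 -> iota_quot (\pi_(Zhat_quot q) z) = iota_quot (\pi_(Zhat_quot q) w) ->
  \pi_(Zhat_quot q) z = \pi_(Zhat_quot q) w.
  move=> q1 zw; apply/(pi_qpow q_unit); apply: (addIr (-1)).
  by rewrite -!(iota_quotE q_unit q1) zw.
by rewrite /Cq; case: (q == 1) => //= + zw; exact.
Qed.

Lemma continuous_iota_toCq : continuous (fun z => iota_q q (toCq q z)).
Proof.
have [q1|q1] := eqVneq q 1.
  rewrite (_ : (fun z => _) = Zhat_Zp p_pr); first exact: continuous_Zhat_Zp.
  by apply/funext => z; rewrite iota_toCqE q1 eqxx.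
rewrite (_ : (fun z => _) = @iota_quot _ p_pr q \o \pi_(Zhat_quot q)).
  have [ic _ _] := iota_quotP q_unit q1.
  by move=> z; apply: continuous_comp; [exact: pi_continuous|exact: ic].
by apply/funext => z; rewrite iota_toCqE (negPf q1).
Qed.

Lemma iota_toCq_natr n : iota_q q (toCq q n%:R) = \sum_(i < n) q ^+ i.
Proof.
rewrite iota_toCqE; case: eqVneq => [->|q1].
  rewrite Zhat_Zp_natr (eq_bigr (fun=> 1)) ?sumr_const ?card_ord //.
  by move=> i _; rewrite expr1n.
have q10 : q - 1 != 0 by rewrite subr_eq0.
apply: (mulIf q10); rewrite (iota_quotE q_unit q1) mulrC -subrX1.
by rewrite (is_qpow_natr (qpowP q_unit)).
Qed.

Lemma iota_toCq0 : iota_q q (toCq q 0) = 0.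
Proof. by rewrite (iota_toCq_natr 0) big_ord0. Qed.

Lemma iota_toCq_approx z k : exists n,
  iota_q q (toCq q z) k = (\sum_(i < n) q ^+ i) k /\
  Zhat_Zp p_pr z k = (n%:R : Zp) k.
Proof.
have [n [zn1 zn2]] := Zhat_approx z k continuous_iota_toCq.
by exists n; rewrite -iota_toCq_natr.
Qed.

(** * Sufficiency of the congruences on [q] *)

Section Isometry.
Hypotheses (q_U1 : padic_U 1 q) (q_U2 : p = 2%N -> padic_U 2 q).

Lemma eq_residue_sum_exp m n k :
  (\sum_(i < m) q ^+ i) k = (\sum_(i < n) q ^+ i) k <->
  (m%:R : Zp) k = (n%:R : Zp) k.
Proof.
(* [q] is approximated at level [k.+2], so that its residues modulo [p] and [p ^ 2] remain visible
   even when [k < 2]. *)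
have Qq i : (i <= k.+2)%N -> padic_U i q -> (`|q k.+2| = 1 %[mod p ^ i])%N.
  move=> ik /padic_UP; rewrite (residue_natr_abs q ik) -[1]/(1%:R) !padic_natr.
  by case.
have Q1 : (`|q k.+2| = 1 %[mod p])%N by have := Qq 1%N isT q_U1; rewrite expn1.
have Q4 : p = 2%N -> (`|q k.+2| = 1 %[mod 4])%N.
  by move=> p2; have := Qq 2 isT (q_U2 p2); rewrite (_ : p ^ 2 = 4)%N // p2.
have qk : q k = (`|q k.+2|%:R : Zp) k.
  by apply: residue_natr_abs; rewrite -addn2 leq_addr.
rewrite !(residue_sum_exp _ qk) !padic_natr.
have E := eq_geom p_pr m n k Q1 Q4.
by split=> -[/eqP mn]; congr Posz; apply/eqP; rewrite ?E // -E.
Qed.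

Lemma eq_residue_iota z w k :
  iota_q q (toCq q z) k = iota_q q (toCq q w) k <->
  Zhat_Zp p_pr z k = Zhat_Zp p_pr w k.
Proof.
have [m [-> ->]] := iota_toCq_approx z k.
have [n [-> ->]] := iota_toCq_approx w k.
exact: eq_residue_sum_exp.
Qed.

(** Counting: [n] mapped to its sum is injective on the [p ^ k] residues, hence bijective. *)
Lemma residue_sum_exp_surj y k : exists n, (\sum_(i < n) q ^+ i) k = y k.
Proof.
have lt_res x : (`|x k| < p ^ k)%N.
  by rewrite residue_nat ltn_mod expp_gt0.
pose f (i : 'I_(p ^ k)) : 'I_(p ^ k) := Ordinal (lt_res (\sum_(j < i) q ^+ j)).
have f_inj : injective f.
  move=> i j [] fij; apply: val_inj => /=.
  have /eq_residue_sum_exp : (\sum_(l < i) q ^+ l) k = (\sum_(l < j) q ^+ l) k.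
    by rewrite -[LHS]gez0_abs ?residue_ge0 // fij gez0_abs ?residue_ge0.
  by rewrite !padic_natr => -[]; rewrite !modn_small.
exists (invF f_inj (Ordinal (lt_res y))).
have /(congr1 val) /= := f_invF f_inj (Ordinal (lt_res y)).
by move=> yE; rewrite -[LHS]gez0_abs ?residue_ge0 // yE gez0_abs ?residue_ge0.
Qed.

(** The solutions [n k] found at each level are compatible because a sum modulo [p ^ i] determines
    its length modulo [p ^ i]. Their limit in [Z_p] lifts to [Zhat]. *)
Lemma iota_toCq_surj y : exists z, iota_q q (toCq q z) = y.
Proof.
have [n nE] := choice (residue_sum_exp_surj y).
have aP : adic_compat (expn p) (fun k => ((n k)%:R : Zp) k).
  move=> i j; rewrite dvdn_Pexp2l ?prime_gt1 // => ij.
  rewrite padic_residue_lt //; apply/eq_residue_sum_exp.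
  by rewrite nE; exact: eq_residue_le ij _.
have [z zE] := Zhat_Zp_surj (mk_adic aP : Zp).
exists z; apply/adicP => k; rewrite -nE -iota_toCq_natr.
by apply/eq_residue_iota; rewrite zE Zhat_Zp_natr.
Qed.

Lemma Cq_is_Zp_U : Cq_is_Zp q.
Proof.
move=> z w; split=> zw.
  by apply/adicP => k; apply/eq_residue_iota; rewrite zw.
by apply/toCq_inj/adicP => k; apply/eq_residue_iota; rewrite zw.
Qed.

(** The comparison of residues with [w = 0], where the cocycle vanishes. *)
Lemma vp_iota_toCq z : vp (iota_q q (toCq q z)) = vp (Zhat_Zp p_pr z).
Proof.
apply: eq_vp => k; have := eq_residue_iota z 0 k.
by rewrite iota_toCq0 (Zhat_Zp_natr 0) /= mod0z.
Qed.

Lemma iota_q_isometry (R : realType) (d : Cq q -> Cq q -> R) :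
  Cq_metric d -> is_isometry d (padic_dist R) (iota_q q).
Proof.
move=> [/(_ Cq_is_Zp_U) dE _]; split=> [y|c e].
  by have [z <-] := iota_toCq_surj y; exists (toCq q z).
have [z <-] := toCq_surj c; have [w <-] := toCq_surj e.
by rewrite dE; apply: eq_padic_dist => k; exact: eq_residue_iota.
Qed.

End Isometry.

(** * Necessity of the congruences on [q] *)

Section Surjective.
Hypothesis iota_surj : forall y, exists c, iota_q q c = y.

Lemma geom_surj_residue (c k : nat) :
  exists n, (geom `|q k| n = c %[mod p ^ k])%N.
Proof.
have [e eE] := iota_surj c%:R; have [z zE] := toCq_surj e.
have [n []] := iota_toCq_approx z k; rewrite zE eE => cE _; exists n.
move: cE; rewrite (residue_sum_exp _ (residue_natr_abs q (leqnn k))) !padic_natr.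
by case.
Qed.

Lemma iota_surj_U1 : padic_U 1 q.
Proof.
apply/padic_UP; rewrite (residue_natr_abs q (leqnn 1)) -[1 in RHS]/(1%:R).
rewrite !padic_natr expn1; congr Posz; apply: (geom_surj_mod p_pr); last first.
  by move=> c; have := geom_surj_residue c 1; rewrite expn1.
(* A unit is nonzero modulo [p]. *)
apply/negP => pq; have q10 : q 1 = 0.
  by rewrite (residue_natr_abs q (leqnn 1)) padic_natr expn1; congr Posz; apply/eqP.
have := congr1 (fun x : Zp => x 1%N) (mulVr q_unit).
by rewrite /= q10 mulr0 mod0z modz_small // ltz_nat expn1 prime_gt1.
Qed.

Lemma iota_surj_U2 : p = 2%N -> padic_U 2 q.
Proof.
move=> p2; have /padic_UP := iota_surj_U1.
have p4 : (p ^ 2 = 4)%N by rewrite p2.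
rewrite (@residue_natr_abs q 1 2) // -[1 in RHS]/(1%:R) !padic_natr expn1 => -[].
rewrite [X in (_ %% X)%N]p2 [X in _ = (_ %% X)%N]p2 => Q2.
apply/padic_UP; rewrite (residue_natr_abs q (leqnn 2)) -[1 in RHS]/(1%:R).
rewrite !padic_natr p4; congr Posz.
(* The value 2 modulo 4 is the one missed when [q] is 3 modulo 4; as [q] is odd, only 1 remains. *)
have [n] := geom_surj_residue 2 2; rewrite p4 => gn.
have Q3 : (`|q 2| <> 3 %[mod 4])%N by move=> /geom_mod4/(_ gn).
by lia.
Qed.

End Surjective.
End Iota.
End Padic.

Theorem corollary3p3 (R : realType) (p : nat) (p_pr : prime p)
    (q : padic_int p_pr) (q_unit : q \is a GRing.unit)
    (d : Cq q -> Cq q -> R) (d_metric : Cq_metric d) :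
  (is_isometry d (padic_dist R) (iota_q q) <->
     (odd p /\ padic_U 1 q) \/ (p = 2%N /\ padic_U 2 q)) /\
  (is_isometry d (padic_dist R) (iota_q q) ->
     Cq_is_Zp q /\
     forall z : Zhat, vp (iota_q q (toCq q z)) = vp (Zhat_Zp p_pr z)).
Proof.
have isoU : is_isometry d (padic_dist R) (iota_q q) ->
    padic_U 1 q /\ (p = 2%N -> padic_U 2 q).
  by case=> sj _; split; [exact: iota_surj_U1|exact: iota_surj_U2].
split; last first.
  move=> /isoU[U1 U2]; split; first exact: Cq_is_Zp_U.
  exact: vp_iota_toCq.
split=> [/isoU[U1 U2]|H].
  by case: (even_prime p_pr) => [p2|podd]; [right; split=> //; exact: U2|left].
have [U1 U2] : padic_U 1 q /\ (p = 2%N -> padic_U 2 q).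
  case: H => [[podd U1]|[p2 U2]]; last first.
    (* U^(2) lies in U^(1), since the residue modulo [p ^ 2] determines the one modulo [p]. *)
    by split=> //; apply/padic_UP/(@eq_residue_le _ _ _ _ 1 2) => //; apply/padic_UP.
  split=> // p2; have: ~~ odd p by rewrite p2.
  by rewrite podd.
exact: iota_q_isometry.
Qed.
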